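(* Let $\hat x\in\mathcal{X}$, $\hat y:=K\hat x$, and let the measurements be $Y_i=\hat y+E_i$, $i=1,2,\dots$, where $E_1,E_2,\dots$ are i.i.d. $\mathcal{Y}$-valued random variables whose distribution does not depend on $\hat x$, with $\mathbb{E}[E_1]=0$ and $\mathbb{E}\|E_1\|^2<\infty$. Assume there are $q>0$, $p>1$ with $\sigma_j^2\asymp j^{-q}$ and $\mathbb{E}(E_1,u_j)^2\asymp j^{-p}$. Let $\nu,\rho>0$. Then, as $n\to\infty$, $$\inf_{k\ge 1}\sup_{\hat x\in\mathcal{X}_{\nu,\rho}}\mathbb{E}\|\bar X^n_k-\hat x\|^2\asymp\begin{cases}\frac1n & q-p<-1,\\ \frac{\log(n\rho)}{n} & q-p=-1,\\ \rho^{\frac{q+1-p}{(\nu+1)q+1-p}}\left(\frac1n\right)^{\frac{\nu}{\nu+1-\frac{p-1}{q}}} & q-p>-1.\end{cases}$$ Moreover, for any choice of truncation levels $$k_n\asymp\begin{cases}(\rho n)^{\frac{1}{\nu q}} & q-p\le -1,\\ (\rho n)^{\frac{1}{(1+\nu)q+1-p}} & q-p>-1,\end{cases}$$ one has $\sup_{\hat x\in\mathcal{X}_{\nu,\rho}}\mathbb{E}\|\bar X^n_{k_n}-\hat x\|^2\asymp\inf_{k\ge1}\sup_{\hat x\in\mathcal{X}_{\nu,\rho}}\mathbb{E}\|\bar X^n_k-\hat x\|^2$.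
   Context: $\mathcal{X},\mathcal{Y}$ are infinite-dimensional real separable Hilbert spaces and $K:\mathcal{X}\to\mathcal{Y}$ is a compact linear operator with dense range, with singular value decomposition $(\sigma_j,u_j,v_j)_{j\in\mathbb{N}}$: $(u_j)$ is an orthonormal basis of $\mathcal{Y}$, $(v_j)$ an orthonormal basis of $\mathcal{N}(K)^\perp$, $(\sigma_j)$ is a nonincreasing sequence of positive numbers converging to $0$, and $Kv_j=\sigma_ju_j$. For $\nu,\rho>0$ the source set is $\mathcal{X}_{\nu,\rho}:=\{(K^*K)^{\nu/2}\xi:\xi\in\mathcal{X},\|\xi\|\le\rho\}=\{\sum_{j}\sigma_j^\nu(\xi,v_j)v_j:\|\xi\|\le\rho\}$. Given measurements $Y_1,\dots,Y_n$, $\bar Y_n:=\frac1n\sum_{i=1}^nY_i$ and the spectral cut-off estimator at level $k$ is $\bar X^n_k:=\sum_{j=1}^k\sigma_j^{-1}(\bar Y_n,u_j)v_j$. For positive sequences, $a_j\asymp b_j$ means $c\,b_j\le a_j\le C\,b_j$ for constants $0<c\le C$ independent of the index; in the conclusion the constants are independent of $n$ (they may depend on $p,q,\nu,\rho$ and the noise distribution). *)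

(* Defs.v *)
From HB Require Import structures.
From mathcomp Require Import all_boot all_order all_algebra.
From mathcomp Require Import all_classical all_reals all_analysis.
Set Implicit Arguments. Unset Strict Implicit. Unset Printing Implicit Defensive.
Import Order.TTheory GRing.Theory Num.Theory.
Import numFieldNormedType.Exports.
Local Open Scope classical_set_scope.
Local Open Scope ring_scope.

Definition inner_product (R : realType) (V : normedModType R) (ip : V -> V -> R) :=
  [/\ forall x y, ip x y = ip y x,
      forall (a : R) x y z, ip (a *: x + y) z = a * ip x z + ip y z
    & forall x, ip x x = `|x| ^+ 2].

Definition series_to (R : realType) (V : normedModType R) (f : nat -> V) (x : V) :=
  (fun N : nat => \sum_(j < N) f j) @ \oo --> x.

Definition orthonormal (R : realType) (V : normedModType R) (ip : V -> V -> R)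
  (e : nat -> V) := forall i j, ip (e i) (e j) = (i == j)%:R.

Definition ONB_of (R : realType) (V : normedModType R) (ip : V -> V -> R)
  (S : set V) (e : nat -> V) :=
  [/\ orthonormal ip e, forall j, S (e j)
    & forall x, S x -> series_to (fun j => ip x (e j) *: e j) x].

Definition kernel_perp (R : realType) (X Y : normedModType R)
  (ipX : X -> X -> R) (K : X -> Y) : set X :=
  [set x | forall z, K z = 0 -> ipX x z = 0].

Definition linear_op (R : realType) (X Y : normedModType R) (K : X -> Y) :=
  forall (a : R) x y, K (a *: x + y) = a *: K x + K y.

Definition compact_op (R : realType) (X Y : normedModType R) (K : X -> Y) :=
  compact (closure (K @` [set x : X | `|x| <= 1])).

Definition is_SVD (R : realType) (X Y : normedModType R)
  (ipX : X -> X -> R) (ipY : Y -> Y -> R) (K : X -> Y)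
  (sigma : nat -> R) (u : nat -> Y) (v : nat -> X) :=
  [/\ ONB_of ipY setT u, ONB_of ipX (kernel_perp ipX K) v,
      (forall j, 0 < sigma j) /\ (forall i j, (i <= j)%N -> sigma j <= sigma i),
      sigma @ \oo --> 0
    & forall j, K (v j) = sigma j *: u j].

Definition source_set (R : realType) (X : normedModType R) (ipX : X -> X -> R)
  (sigma : nat -> R) (v : nat -> X) (nu rho : R) : set X :=
  [set x | exists xi : X, `|xi| <= rho /\
      series_to (fun j => (sigma j `^ nu * ipX xi (v j)) *: v j) x].

(* E : Omega -> Y is a (weakly, equivalently by Pettis since Y is separable,
   strongly) measurable Y-valued random variable *)
Definition Y_rv (R : realType) d (T : measurableType d) (Y : normedModType R)
  (ipY : Y -> Y -> R) (E : T -> Y) :=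
  forall y, measurable_fun setT (fun w => ipY (E w) y).

Definition cyl_event (R : realType) d (T : measurableType d) (Y : normedModType R)
  (ipY : Y -> Y -> R) (E : T -> Y) (m : nat) (ys : nat -> Y) (Bs : nat -> set R)
  : set T := [set w | forall k, (k < m)%N -> Bs k (ipY (E w) (ys k))].

(* E_0, E_1, ... are mutually independent: the sigma-algebras sigma(E_i)
   (generated by the cylinder events) are mutually independent *)
Definition mutually_independent (R : realType) d (T : measurableType d)
  (P : probability T R) (Y : normedModType R) (ipY : Y -> Y -> R) (E : nat -> T -> Y) :=
  forall (I : seq nat) (m : nat -> nat) (ys : nat -> nat -> Y) (Bs : nat -> nat -> set R),
    uniq I -> (forall i k, measurable (Bs i k)) ->
    P [set w | forall i, i \in I -> cyl_event ipY (E i) (m i) (ys i) (Bs i) w]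
    = (\prod_(i <- I) P (cyl_event ipY (E i) (m i) (ys i) (Bs i)))%E.

Definition identically_distributed (R : realType) d (T : measurableType d)
  (P : probability T R) (Y : normedModType R) (ipY : Y -> Y -> R) (E : nat -> T -> Y) :=
  forall (i m : nat) (ys : nat -> Y) (Bs : nat -> set R),
    (forall k, measurable (Bs k)) ->
    P (cyl_event ipY (E i) m ys Bs) = P (cyl_event ipY (E 0%N) m ys Bs).

Definition Ybar (R : realType) (T : Type) (X Y : normedModType R) (K : X -> Y)
  (E : nat -> T -> Y) (n : nat) (xh : X) (w : T) : Y :=
  n%:R^-1 *: \sum_(i < n) (K xh + E i w).

Definition Xbar (R : realType) (T : Type) (X Y : normedModType R)
  (ipY : Y -> Y -> R) (K : X -> Y) (sigma : nat -> R) (u : nat -> Y) (v : nat -> X)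
  (E : nat -> T -> Y) (n k : nat) (xh : X) (w : T) : X :=
  \sum_(j < k) ((sigma j)^-1 * ipY (Ybar K E n xh w) (u j)) *: v j.

Definition mse (R : realType) d (T : measurableType d) (P : probability T R)
  (X Y : normedModType R) (ipY : Y -> Y -> R) (K : X -> Y) (sigma : nat -> R)
  (u : nat -> Y) (v : nat -> X) (E : nat -> T -> Y) (n k : nat) (xh : X) : \bar R :=
  (\int[P]_w ((`|Xbar ipY K sigma u v E n k xh w - xh| ^+ 2)%:E))%E.

Definition asymp (R : realType) (a b : nat -> \bar R) :=
  exists c C : R, [/\ 0 < c, 0 < C &
    forall j, (c%:E * b j <= a j)%E /\ (a j <= C%:E * b j)%E].

Definition asymp_n (R : realType) (a b : nat -> \bar R) :=
  exists (c C : R) (N : nat), [/\ 0 < c, 0 < C &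
    forall n, (N <= n)%N -> (c%:E * b n <= a n)%E /\ (a n <= C%:E * b n)%E].

Definition rate (R : realType) (p q nu rho : R) (n : nat) : R :=
  if q - p < -1 then n%:R^-1
  else if q - p == -1 then ln (n%:R * rho) / n%:R
  else rho `^ ((q + 1 - p) / ((nu + 1) * q + 1 - p))
       * (n%:R^-1) `^ (nu / (nu + 1 - (p - 1) / q)).

Definition kn_rate (R : realType) (p q nu rho : R) (n : nat) : R :=
  if q - p <= -1 then (rho * n%:R) `^ (1 / (nu * q))
  else (rho * n%:R) `^ (1 / ((1 + nu) * q + 1 - p)).

(* Main.v *)
Require Import Defs.
From HB Require Import structures.
From mathcomp Require Import all_boot all_order all_algebra.
From mathcomp Require Import all_classical all_reals all_analysis.
From mathcomp Require Import measurable_realfun ring lra.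
Import Order.TTheory GRing.Theory Num.Theory.
Import numFieldNormedType.Exports.
Local Open Scope classical_set_scope.
Local Open Scope ring_scope.

(** Expanding in the singular basis, the error of the cut-off estimator is the
    averaged noise in the first [k] coordinates minus the tail of [xh]. Pythagoras
    and the pairwise independence of the noise turn its mean square into
    [n^-1 * sum_(j < k) s_j / sigma_j^2] plus the squared norm of the tail, where
    [s_j] is the second moment of the [j]-th noise coordinate. On the source set the
    squared tail is at most [rho^2 * sigma_k^(2 nu)], with equality for the source
    element [rho *: v k]. So the worst risk is comparable to
    [n^-1 * sum_(1 <= j <= k) j^(q-p) + k^(- nu q)], and what remains is to balance
    an increasing and a decreasing function of [k]. *)

(** * Independent random variables *)

(** Independence says that the law of the pair and the product of the two laws agree on rectangles.
    Uniqueness of the product measure identifies them, and Fubini splits the integral. *)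
Lemma integral_joint_independent (R : realType) (d d1 d2 : measure_display)
    (T : measurableType d) (T1 : measurableType d1) (T2 : measurableType d2)
    (P : probability T R) (X : {mfun T >-> T1}) (Y : {mfun T >-> T2})
    (h : T1 * T2 -> \bar R) :
  (forall A B, measurable A -> measurable B ->
     P (X @^-1` A `&` Y @^-1` B) = (P (X @^-1` A) * P (Y @^-1` B))%E) ->
  measurable_fun setT h -> P.-integrable setT (fun w => h (X w, Y w)) ->
  (\int[P]_w h (X w, Y w) =
   \int[distribution P X]_x \int[distribution P Y]_y h (x, y))%E.
Proof.
move=> ind mh inth.
have mXY : measurable_fun setT (fun w => (X w, Y w)) by exact: measurable_fun_pair.
pose XY : {mfun T >-> (T1 * T2)%type} :=
  HB.pack (fun w => (X w, Y w)) (isMeasurableFun.Build _ _ _ _ _ mXY).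
have prodE A : measurable A ->
    (distribution P X \x distribution P Y)%E A = distribution P XY A.
  by move=> mA; apply: product_measure_unique => // B C mB mC; exact: ind.
have inthXY : (distribution P XY).-integrable setT h.
  by apply: integrable_pushforward.
have inth2 : (distribution P X \x distribution P Y)%E.-integrable setT h.
  apply/integrableP; split => //.
  have /integrableP[_] := inthXY; congr (_ < _)%E.
  by apply: eq_measure_integral => A mA _; exact/esym/prodE.
rewrite [LHS](_ : _ = \int[P]_w (h \o XY) w)%E//.
rewrite -(integral_distribution (P := P) (X := XY))//.
rewrite [RHS](integral12_prod_meas1 inth2).
by apply: eq_measure_integral => A mA _; exact/esym/prodE.
Qed.

Lemma integral_mul_independent (R : realType) (d : measure_display)
    (T : measurableType d) (P : probability T R) (f g : T -> R) :
  measurable_fun setT f -> measurable_fun setT g ->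
  (forall A B : set R, measurable A -> measurable B ->
     P (f @^-1` A `&` g @^-1` B) = (P (f @^-1` A) * P (g @^-1` B))%E) ->
  P.-integrable setT (EFin \o f) -> P.-integrable setT (EFin \o g) ->
  P.-integrable setT (fun w => (f w * g w)%:E) ->
  (\int[P]_w (f w * g w)%:E = (\int[P]_w (f w)%:E) * \int[P]_w (g w)%:E)%E.
Proof.
move=> mf mg ind intf intg intfg.
pose X : {mfun T >-> R} := HB.pack f (isMeasurableFun.Build _ _ _ _ _ mf).
pose Y : {mfun T >-> R} := HB.pack g (isMeasurableFun.Build _ _ _ _ _ mg).
have mid : measurable_fun setT (fun y : R => y%:E) by exact/measurable_EFinP.
have iY : (\int[distribution P Y]_y y%:E = \int[P]_w (g w)%:E)%E.
  by rewrite (integral_distribution (P := P) (X := Y)).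
have iX : (\int[distribution P X]_y y%:E = \int[P]_w (f w)%:E)%E.
  by rewrite (integral_distribution (P := P) (X := X)).
have intY : (distribution P Y).-integrable setT (fun y : R => y%:E).
  by apply: integrable_pushforward.
have intX : (distribution P X).-integrable setT (fun y : R => y%:E).
  by apply: integrable_pushforward.
have gfin : (\int[P]_w (g w)%:E)%E \is a fin_num by exact: integrable_fin_num.
rewrite (@integral_joint_independent _ _ _ _ _ _ _ P X Y
  (fun z => (z.1 * z.2)%:E))//; last first.
  by apply/measurable_EFinP; apply: measurable_funM.
under eq_integral => x _.
  rewrite /=; under eq_integral do rewrite EFinM.
  rewrite integralZl// iY.
  over.
by rewrite /= -(fineK gfin) integralZr // iX.
Qed.

Lemma ge0_integral_identically_distributed (R : realType) (d : measure_display)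
    (T : measurableType d) (P : probability T R) (f g : T -> R) (h : R -> \bar R) :
  measurable_fun setT f -> measurable_fun setT g ->
  (forall A : set R, measurable A -> P (f @^-1` A) = P (g @^-1` A)) ->
  measurable_fun setT h -> (forall x, 0 <= h x)%E ->
  (\int[P]_w (h \o f) w = \int[P]_w (h \o g) w)%E.
Proof.
move=> mf mg fg mh h0.
pose X : {mfun T >-> R} := HB.pack f (isMeasurableFun.Build _ _ _ _ _ mf).
pose Y : {mfun T >-> R} := HB.pack g (isMeasurableFun.Build _ _ _ _ _ mg).
rewrite -[LHS](ge0_integral_distribution (P := P) X mh h0).
rewrite -[RHS](ge0_integral_distribution (P := P) Y mh h0).
by apply: eq_measure_integral => A mA _; exact: fg.
Qed.

(** Positive and negative parts reduce this to the nonnegative case. Signed [h] are needed to carry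
    the zero mean of [xi 0] over to every [xi i]. *)
Lemma integral_identically_distributed (R : realType) (d : measure_display)
    (T : measurableType d) (P : probability T R) (f g : T -> R) (h : R -> \bar R) :
  measurable_fun setT f -> measurable_fun setT g ->
  (forall A : set R, measurable A -> P (f @^-1` A) = P (g @^-1` A)) ->
  measurable_fun setT h ->
  (\int[P]_w (h \o f) w = \int[P]_w (h \o g) w)%E.
Proof.
move=> mf mg fg mh.
rewrite [LHS]integralE [RHS]integralE (funepos_comp h f) (funepos_comp h g).
rewrite (funeneg_comp h f) (funeneg_comp h g).
have mp := measurable_funepos mh; have mn := measurable_funeneg mh.
rewrite (@ge0_integral_identically_distributed _ _ _ P f g _ mf mg fg mp)//.
by rewrite (@ge0_integral_identically_distributed _ _ _ P f g _ mf mg fg mn).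
Qed.

(** The square expands into a double sum whose off-diagonal terms vanish by pairwise independence
    and centering. The [n] diagonal terms against the factor [n^-2] leave [s / n]. *)
Lemma second_moment_mean (R : realType) (d : measure_display)
    (T : measurableType d) (P : probability T R) (xi : nat -> T -> R) (s : R) (n : nat) :
  (0 < n)%N ->
  (forall i, measurable_fun setT (xi i)) ->
  (forall i l, i != l -> forall A B : set R, measurable A -> measurable B ->
     P (xi i @^-1` A `&` xi l @^-1` B) = (P (xi i @^-1` A) * P (xi l @^-1` B))%E) ->
  (forall i (A : set R), measurable A -> P (xi i @^-1` A) = P (xi 0%N @^-1` A)) ->
  P.-integrable setT (fun w => (xi 0%N w)%:E) ->
  (\int[P]_w (xi 0%N w)%:E = 0)%E ->
  (\int[P]_w (xi 0%N w ^+ 2)%:E = s%:E)%E ->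
  (\int[P]_w ((n%:R^-1 * \sum_(i < n) xi i w) ^+ 2)%:E = (n%:R^-1 * s)%:E)%E.
Proof.
move=> n0 mxi ind idist int0 mean0 var0.
have same i (h : R -> \bar R) : measurable_fun setT h ->
    (\int[P]_w h (xi i w) = \int[P]_w h (xi 0%N w))%E.
  by apply: integral_identically_distributed => // A mA; exact: idist.
have mid : measurable_fun setT (fun x : R => x%:E) by exact/measurable_EFinP.
have msq : measurable_fun setT (fun x : R => (x ^+ 2)%:E).
  by apply/measurable_EFinP; exact: measurable_funX.
have mean i : (\int[P]_w (xi i w)%:E = 0)%E by rewrite (same i _ mid).
have var i : (\int[P]_w (xi i w ^+ 2)%:E = s%:E)%E by rewrite (same i _ msq).
have int1 i : P.-integrable setT (fun w => (xi i w)%:E).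
  apply/integrableP; split; first exact/measurable_EFinP.
  have /integrableP[_] := int0.
  by rewrite (same i (fun x => `|x%:E|%E))//; exact: measurableT_comp.
have int2 i : P.-integrable setT (fun w => (xi i w ^+ 2)%:E).
  apply/integrableP; split; first exact/measurable_EFinP/measurable_funX.
  under eq_integral do rewrite gee0_abs ?lee_fin ?sqr_ge0//.
  by rewrite var ltry.
(* Products are dominated by [xi i w ^+ 2 + xi l w ^+ 2], so square integrability suffices. *)
have intM i l : P.-integrable setT (fun w => (xi i w * xi l w)%:E).
  apply: (@le_integrable _ _ _ _ _ measurableT _
    (fun w => (xi i w ^+ 2)%:E + (xi l w ^+ 2)%:E)%E).
  - by apply/measurable_EFinP; exact: measurable_funM.
  - move=> w _; rewrite -EFinD !abse_EFin lee_fin.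
    by rewrite [leRHS]ger0_norm ?addr_ge0 ?sqr_ge0// ler_norml; apply/andP; split; nra.
  - exact: integrableD.
have cov i l : (\int[P]_w (xi i w * xi l w)%:E = ((i == l)%:R * s)%:E)%E.
  have [->|il] := eqVneq i l.
    by rewrite mul1r -(var l); apply: eq_integral => w _; rewrite expr2.
  rewrite (@integral_mul_independent _ _ _ P (xi i) (xi l) (mxi i) (mxi l)
    (ind _ _ il) (int1 i) (int1 l) (intM i l)).
  by rewrite mean mul0e mul0r.
transitivity (\int[P]_w ((n%:R ^- 2)%:E *
    (\sum_(i < n) \sum_(l < n) (xi i w * xi l w)%:E)))%E.
  apply: eq_integral => w _; under [X in _ = (_ * X)%E]eq_bigr do rewrite sumEFin.
  rewrite sumEFin -EFinM; congr _%:E.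
  rewrite exprMn exprVn; congr (_ * _); rewrite expr2 mulr_suml.
  by apply: eq_bigr => i _; rewrite mulr_sumr.
rewrite integralZl//; last first.
  by apply: integrable_sum => // i _; apply: integrable_sum.
rewrite (@integral_sum _ _ _ P _ measurableT _ (fun (i : 'I_n) w =>
  \sum_(l < n) (xi i w * xi l w)%:E)%E); last by move=> i; exact: integrable_sum.
under eq_bigr => i _.
  rewrite (@integral_sum _ _ _ P _ measurableT _ (fun (l : 'I_n) w =>
    (xi i w * xi l w)%:E)%E)//.
  rewrite (eq_bigr (fun l : 'I_n => (((i : nat) == l)%:R * s)%:E))//.
  rewrite sumEFin (bigD1 i)//= eqxx mul1r big1 ?addr0; last first.
    by move=> l li; rewrite eq_sym (negbTE (_ : (l : nat) != i)) ?mul0r.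
  over.
rewrite sumEFin sumr_const card_ord -EFinM; congr _%:E.
have nn0 : n%:R != 0 :> R by rewrite pnatr_eq0 -lt0n.
by rewrite -mulr_natl; field.
Qed.

(** * Orthonormal systems *)

Section inner_product_lemmas.
Set Implicit Arguments. Unset Strict Implicit.
Context {R : realType} {V : normedModType R} {ip : V -> V -> R}.
Hypothesis ipP : inner_product ip.

Lemma ipC x y : ip x y = ip y x.
Proof. by case: ipP. Qed.

Lemma ip0l z : ip 0 z = 0.
Proof.
case: ipP => _ lin _; have := lin 1 0 0 z.
rewrite scaler0 addr0 mul1r; lra.
Qed.

Lemma ipDl x y z : ip (x + y) z = ip x z + ip y z.
Proof. by case: ipP => _ lin _; rewrite -[x]scale1r lin mul1r scale1r. Qed.

Lemma ipZl a x z : ip (a *: x) z = a * ip x z.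
Proof. by case: ipP => _ lin _; rewrite -[a *: x]addr0 lin ip0l addr0. Qed.

Lemma ipNl x z : ip (- x) z = - ip x z.
Proof. by rewrite -scaleN1r ipZl mulN1r. Qed.

Lemma ip_suml I (s : seq I) (f : I -> V) z :
  ip (\sum_(i <- s) f i) z = \sum_(i <- s) ip (f i) z.
Proof.
elim: s => [|i s IHs]; first by rewrite !big_nil ip0l.
by rewrite !big_cons ipDl IHs.
Qed.

Lemma normD_sq x y : `|x + y| ^+ 2 = `|x| ^+ 2 + 2 * ip x y + `|y| ^+ 2.
Proof.
case: ipP => _ _ nrm; rewrite -!nrm ipDl [ip x _]ipC [ip y (_ + _)]ipC !ipDl.
by rewrite [ip y x]ipC; ring.
Qed.

Context {e : nat -> V}.
Hypothesis eP : Defs.orthonormal ip e.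

Lemma ip_orthonormal_sum (s : seq nat) (a : nat -> R) i : uniq s ->
  ip (\sum_(j <- s) a j *: e j) (e i) = if i \in s then a i else 0.
Proof.
move=> us; rewrite ip_suml; under eq_bigr do rewrite ipZl eP.
case: ifPn => [si|si].
  rewrite (bigD1_seq i)//= eqxx mulr1 big1 ?addr0// => j ji.
  by rewrite (negbTE ji) mulr0.
rewrite big_seq big1// => j sj; case: eqP => [ji|]; last by rewrite mulr0.
by rewrite ji (negbTE si) in sj.
Qed.

Lemma norm_orthonormal_sum (s : seq nat) (a : nat -> R) : uniq s ->
  `|\sum_(j <- s) a j *: e j| ^+ 2 = \sum_(j <- s) a j ^+ 2.
Proof.
move=> us; case: ipP => _ _ <-; rewrite ip_suml big_seq [RHS]big_seq.
apply: eq_bigr => j sj.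
by rewrite ipZl ipC ip_orthonormal_sum// sj expr2.
Qed.

(** The squared norm of [x - S] is nonnegative for the finite projection [S], and both [ip x S] and
    the squared norm of [S] equal the sum on the left. *)
Lemma bessel (s : seq nat) x : uniq s ->
  \sum_(j <- s) ip x (e j) ^+ 2 <= `|x| ^+ 2.
Proof.
move=> us; set S := \sum_(j <- s) ip x (e j) *: e j.
have xS : ip x S = \sum_(j <- s) ip x (e j) ^+ 2.
  rewrite ipC /S ip_suml; apply: eq_bigr => j _.
  by rewrite ipZl [ip (e j) x]ipC expr2.
have := sqr_ge0 `|x - S|.
rewrite normD_sq normrN (norm_orthonormal_sum _ us) ipC ipNl [ip S x]ipC xS.
lra.
Qed.

Lemma pythagoras_sub (s : seq nat) (a : nat -> R) r : uniq s ->
  (forall j, j \in s -> ip r (e j) = 0) ->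
  `|\sum_(j <- s) a j *: e j - r| ^+ 2 = \sum_(j <- s) a j ^+ 2 + `|r| ^+ 2.
Proof.
move=> us r0; rewrite normD_sq normrN norm_orthonormal_sum// ipC ipNl ipC ip_suml.
rewrite [X in 2 * - X]big_seq [X in 2 * - X]big1; first by rewrite oppr0 mulr0 addr0.
by move=> j sj; rewrite ipZl [ip _ r]ipC r0// mulr0.
Qed.

(** Bessel for the single vector [e j] bounds a coefficient by the norm, so taking a coefficient is
    1-Lipschitz. *)
Lemma ip_cvg (f : nat -> V) x j : f n @[n --> \oo] --> x ->
  ip (f n) (e j) @[n --> \oo] --> ip x (e j).
Proof.
move=> fx; apply/cvgrPdist_le => eps eps0.
have /cvgrPdist_le /(_ _ eps0) := fx.
apply: filterS => n; apply: le_trans; rewrite -ipNl -ipDl.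
have := @bessel [:: j] (x - f n) isT; rewrite big_seq1.
by rewrite -real_normK ?num_real// ler_pXn2r// nnegrE.
Qed.

Lemma ip_series_to (a : nat -> R) x i :
  series_to (fun j => a j *: e j) x -> ip x (e i) = a i.
Proof.
move=> ax; have := @ip_cvg _ _ i ax.
(* The coefficient of the partial sums is constantly [a i] as soon as [i < n]. *)
have /cvg_lim <- // : ip (\sum_(j < n) a j *: e j) (e i) @[n --> \oo] --> a i.
  apply: cvg_near_cst; exists i.+1 => // n /= ni.
  rewrite -(big_mkord xpredT (fun j => a j *: e j)) ip_orthonormal_sum.
    by rewrite mem_index_iota ni.
  exact: iota_uniq.
by move/cvg_lim => ->.
Qed.

(** Subtracting a finite sum, rather than summing an infinite tail, raises no question of
    convergence. *)
Definition proj_tail (k : nat) (x : V) := x - \sum_(j < k) ip x (e j) *: e j.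

Lemma ip_proj_tail k x j : (j < k)%N -> ip (proj_tail k x) (e j) = 0.
Proof.
move=> jk; rewrite /proj_tail ipDl ipNl.
rewrite -(big_mkord xpredT (fun j => ip x (e j) *: e j)).
by rewrite ip_orthonormal_sum ?iota_uniq// mem_index_iota jk subrr.
Qed.

(** The tail is the limit of the blocks [k <= j < n]. On a block the decreasing weights are at most
    [w k] and Bessel bounds what remains by the norm of [xi]; the bound survives the limit. *)
Lemma norm_proj_tail_le (w : nat -> R) k x xi :
  (forall j, 0 <= w j) -> (forall i j, (i <= j)%N -> w j <= w i) ->
  series_to (fun j => (w j * ip xi (e j)) *: e j) x ->
  `|proj_tail k x| ^+ 2 <= w k ^+ 2 * `|xi| ^+ 2.
Proof.
move=> w0 wdec wx.
have cx i : ip x (e i) = w i * ip xi (e i) by exact: (ip_series_to i wx).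
rewrite -exprMn ler_pXn2r ?nnegrE ?mulr_ge0//.
have tailx : (\sum_(j < n) (w j * ip xi (e j)) *: e j) -
    (\sum_(j < k) ip x (e j) *: e j) @[n --> \oo] --> proj_tail k x.
  by apply: cvgB => //; exact: cvg_cst.
apply: (cvgr_to_le (cvg_norm tailx)); exists k => // n /= kn.
rewrite -(ler_pXn2r (n := 2)) ?nnegrE ?mulr_ge0// exprMn.
have -> : \sum_(j < n) (w j * ip xi (e j)) *: e j -
    \sum_(j < k) ip x (e j) *: e j =
    \sum_(k <= j < n) (w j * ip xi (e j)) *: e j.
  rewrite -(big_mkord xpredT (fun j => (w j * ip xi (e j)) *: e j)).
  under [X in _ - X]eq_bigr do rewrite cx.
  rewrite -[X in _ - X](big_mkord xpredT (fun j => (w j * ip xi (e j)) *: e j)).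
  by rewrite [X in X - _](@big_cat_nat _ _ _ k)//= [X in X - _]addrC addrK.
rewrite norm_orthonormal_sum ?iota_uniq//.
apply: (@le_trans _ _ (w k ^+ 2 * \sum_(k <= j < n) ip xi (e j) ^+ 2)).
  rewrite mulr_sumr big_nat [leRHS]big_nat; apply: ler_sum => j /andP[kj _].
  by rewrite exprMn ler_wpM2r ?sqr_ge0// ler_pXn2r ?nnegrE// wdec.
by rewrite ler_wpM2l ?sqr_ge0// bessel// iota_uniq.
Qed.

(** Indices start at 0, so [e k] is the first vector dropped at level [k] and lies entirely in the
    tail. This makes the preceding bound sharp. *)
Lemma norm_proj_tail_basis (c : R) k : `|proj_tail k (c *: e k)| ^+ 2 = c ^+ 2.
Proof.
rewrite /proj_tail big1 => [|j _]; last first.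
  by rewrite ipZl eP gtn_eqF// mulr0 scale0r.
case: ipP => _ _ <-; rewrite subr0 ipZl ipC ipZl eP eqxx mulr1.
by rewrite expr2.
Qed.

End inner_product_lemmas.

(** * The worst-case risk *)

Section mean_square_error.
Set Implicit Arguments. Unset Strict Implicit.
Context {R : realType} {X Y : normedModType R}
  {ipX : X -> X -> R} {ipY : Y -> Y -> R} {K : X -> Y}
  {sigma : nat -> R} {u : nat -> Y} {v : nat -> X}.
Hypotheses (ipXP : inner_product ipX) (ipYP : inner_product ipY)
  (Klin : linear_op K) (Kcont : continuous K) (svd : is_SVD ipX ipY K sigma u v).

Let uP : Defs.orthonormal ipY u. Proof. by case: svd => -[]. Qed.
Let vP : Defs.orthonormal ipX v. Proof. by case: svd => _ []. Qed.
Let sigma_gt0 j : 0 < sigma j. Proof. by case: svd => _ _ [] /(_ j). Qed.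
Let sigma_dec i j : (i <= j)%N -> sigma j <= sigma i.
Proof. by case: svd => _ _ [] _ h _ _; exact: h. Qed.
Let Kv j : K (v j) = sigma j *: u j. Proof. by case: svd. Qed.

(** Continuity lets [K] act termwise, so the expansion of [x] in [v] becomes an expansion of [K x]
    in [u] with coefficients [a i * sigma i], which orthonormality reads off. *)
Lemma svd_coef (a : nat -> R) x j : series_to (fun i => a i *: v i) x ->
  ipY (K x) (u j) = sigma j * ipX x (v j).
Proof.
move=> ax; rewrite (ip_series_to ipXP vP j ax) mulrC.
apply: (ip_series_to ipYP uP (a := fun i => a i * sigma i)).
have K0 : K 0 = 0.
  by have := Klin (-1) 0 0; rewrite scaler0 addr0 scaleN1r addNr.
have -> : (fun i => (a i * sigma i) *: u i) = (fun i => K (a i *: v i)).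
  apply/funext => i; have := Klin (a i) (v i) 0.
  by rewrite K0 !addr0 Kv scalerA => ->.
rewrite /series_to.
have -> : (fun N => \sum_(j0 < N) K (a j0 *: v j0)) =
    K \o (fun N => \sum_(i < N) a i *: v i).
  apply/funext => N /=; elim: N => [|N IHN]; first by rewrite !big_ord0 K0.
  rewrite !big_ord_recr/= IHN; have := Klin 1 (\sum_(i < N) a i *: v i) (a N *: v N).
  by rewrite !scale1r.
by apply: (@cvg_comp _ _ _ _ K _ _ _ ax); exact: Kcont.
Qed.

Context {d : measure_display} {T : measurableType d} {P : probability T R}
  {E : nat -> T -> Y} {s : nat -> R}.
Hypotheses (mE : forall i, Y_rv ipY (E i)) (indE : mutually_independent P ipY E)
  (idE : identically_distributed P ipY E)
  (meanE : forall y, P.-integrable setT (fun w => (ipY (E 0%N w) y)%:E) /\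
             (\int[P]_w (ipY (E 0%N w) y)%:E = 0)%E)
  (varE : forall j, (\int[P]_w ((ipY (E 0%N w) (u j)) ^+ 2)%:E = (s j)%:E)%E).

Lemma noise_coef_second_moment n j : (0 < n)%N ->
  (\int[P]_w ((n%:R^-1 * \sum_(i < n) ipY (E i w) (u j)) ^+ 2)%:E =
   (n%:R^-1 * s j)%:E)%E.
Proof.
move=> n0.
(* A condition on one coordinate is a cylinder event with a single test vector. This turns the
   hypotheses on the law of the noise into statements about real random variables. *)
have cylE i (A : set R) : cyl_event ipY (E i) 1 (fun=> u j) (fun=> A) =
    (fun w => ipY (E i w) (u j)) @^-1` A.
  by apply/seteqP; split => w /= h; [exact: (h 0%N) | move=> [|//]].
apply: (@second_moment_mean _ _ _ P (fun i w => ipY (E i w) (u j))) => //.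
- by move=> i; exact: mE.
- move=> i l il A B mA mB.
  have uil : uniq [:: i; l] by rewrite /= inE il.
  have := @indE [:: i; l] (fun=> 1%N) (fun _ _ => u j)
    (fun k _ => if k == i then A else B) uil.
  rewrite !big_cons big_nil mule1 !cylE eqxx (eq_sym l i) (negbTE il) => <-; last first.
    by move=> k _; case: ifP.
  congr (P _); apply/seteqP; split => w /=.
    move=> [wA wB] k; rewrite !inE => /orP[] /eqP -> [|//] _; rewrite ?eqxx//.
    by rewrite eq_sym (negbTE il).
  move=> h; split.
    by have := h i; rewrite !inE eqxx => /(_ isT 0%N isT).
  by have := h l; rewrite !inE eqxx orbT eq_sym (negbTE il) => /(_ isT 0%N isT).
- move=> i A mA; rewrite -!cylE; exact: (@idE i 1%N (fun=> u j) (fun=> A)).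
- by case: (meanE (u j)).
- by case: (meanE (u j)).
Qed.

(** For [j < k] the signal part of the data reproduces the coefficient of [x] exactly, so only noise
    remains in these coordinates. The tail is orthogonal to them and deterministic. *)
Lemma mse_formula n k (a : nat -> R) x : (0 < n)%N ->
  series_to (fun i => a i *: v i) x ->
  mse P ipY K sigma u v E n k x =
  (n%:R^-1 * \sum_(j < k) s j / sigma j ^+ 2 +
     `|proj_tail (ip := ipX) (e := v) k x| ^+ 2)%:E.
Proof.
move=> n0 ax.
have nn0 : n%:R != 0 :> R by rewrite pnatr_eq0 -lt0n.
have normE w : `|Xbar ipY K sigma u v E n k x w - x| ^+ 2 =
    \sum_(j < k) (sigma j ^- 2 * (n%:R^-1 * \sum_(i < n) ipY (E i w) (u j)) ^+ 2) +
    `|proj_tail (ip := ipX) (e := v) k x| ^+ 2.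
  pose c j := (sigma j)^-1 * (n%:R^-1 * \sum_(i < n) ipY (E i w) (u j)).
  have -> : Xbar ipY K sigma u v E n k x w - x =
      \sum_(0 <= j < k) c j *: v j - proj_tail (ip := ipX) (e := v) k x.
    rewrite /proj_tail opprB addrA big_mkord -big_split/=; congr (_ - _).
    apply: eq_bigr => j _; rewrite -scalerDl; congr (_ *: _).
    rewrite /c /Ybar (ipZl ipYP) (ip_suml ipYP).
    under eq_bigr do rewrite (ipDl ipYP).
    rewrite big_split/= sumr_const card_ord (svd_coef j ax) -mulr_natl.
    by field; rewrite nn0 gt_eqF.
  rewrite (pythagoras_sub ipXP vP) ?iota_uniq//; last first.
    by move=> j; rewrite mem_index_iota => /andP[_ jk]; exact: ip_proj_tail.
  rewrite big_mkord; congr (_ + _); apply: eq_bigr => j _.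
  by rewrite /c exprMn exprVn.
rewrite /mse; under eq_integral => w _ do rewrite normE EFinD -sumEFin.
have mN j : measurable_fun setT
    (fun w => (n%:R^-1 * \sum_(i < n) ipY (E i w) (u j)) ^+ 2).
  apply: measurable_funX; apply: measurable_funM => //.
  by apply: measurable_sum => i; exact: mE.
have ms j : 0 <= sigma j ^- 2 by rewrite invr_ge0 sqr_ge0.
rewrite ge0_integralD//; first last.
- apply: emeasurable_sum => j; apply/measurable_EFinP.
  by apply: measurable_funM.
- by move=> w _; apply: sume_ge0 => j _; rewrite lee_fin mulr_ge0// sqr_ge0.
rewrite integral_cst// [X in (_ + _ * X)%E]probability_setT mule1 EFinD; congr (_ + _)%E.
rewrite (@ge0_integral_sum _ _ _ P _ measurableT _ (fun (j : 'I_k) w =>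
  (sigma j ^- 2 * (n%:R^-1 * \sum_(i < n) ipY (E i w) (u j)) ^+ 2)%:E)%E); first last.
- by move=> j w _; rewrite lee_fin mulr_ge0// sqr_ge0.
- by move=> j; apply/measurable_EFinP; apply: measurable_funM.
rewrite mulr_sumr -sumEFin; apply: eq_bigr => j _.
under eq_integral do rewrite EFinM.
rewrite ge0_integralZl_EFin//; first last.
- exact/measurable_EFinP.
- by move=> w _; rewrite lee_fin sqr_ge0.
by rewrite noise_coef_second_moment// -EFinM; congr _%:E; rewrite mulrCA [s j / _]mulrC.
Qed.

Lemma worst_mse_formula n k (nu rho : R) : (0 < n)%N -> 0 < nu -> 0 < rho ->
  ereal_sup (mse P ipY K sigma u v E n k @` source_set ipX sigma v nu rho) =
  (n%:R^-1 * \sum_(j < k) s j / sigma j ^+ 2 +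
     rho ^+ 2 * (sigma k `^ nu) ^+ 2)%:E.
Proof.
move=> n0 nu0 rho0; apply/eqP; rewrite eq_le; apply/andP; split.
  apply: ge_ereal_sup => _ [x [xi [xirho xix]] <-].
  rewrite (mse_formula k n0 xix) lee_fin lerD2l.
  apply: le_trans (norm_proj_tail_le (w := fun j => sigma j `^ nu) ipXP vP k _ _ xix) _.
  - by move=> j; exact: powR_ge0.
  - move=> i j ij; apply: (ge0_ler_powR (ltW nu0)); last exact: sigma_dec.
    + by rewrite nnegrE ltW.
    + by rewrite nnegrE ltW.
  - rewrite [leRHS]mulrC; apply: ler_wpM2l; first exact: sqr_ge0.
    by rewrite ler_pXn2r ?nnegrE// ltW.
(* The extremal element comes from [rho *: v k], the largest admissible multiple of the first
   dropped vector. *)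
pose x := (sigma k `^ nu * rho) *: v k.
have xix : series_to (fun j => (sigma j `^ nu * ipX (rho *: v k) (v j)) *: v j) x.
  apply: cvg_near_cst; exists k.+1 => // N /= kN.
  rewrite (bigD1 (Ordinal kN))//= (ipZl ipXP) vP eqxx mulr1 big1 ?addr0// => j jk.
  by rewrite (ipZl ipXP) vP eq_sym (negbTE (_ : (j : nat) != k)) ?mulr0 ?scale0r.
apply: ereal_sup_ubound; exists x.
  exists (rho *: v k); split => //.
  rewrite normrZ gtr0_norm//.
  have v1 : `|v k| ^+ 2 = 1 by case: ipXP => _ _ <-; rewrite vP eqxx.
  by move/eqP: v1; rewrite pexpr_eq1// => /eqP ->; rewrite mulr1.
rewrite (mse_formula k n0 xix) (norm_proj_tail_basis ipXP vP).
by rewrite exprMn [rho ^+ 2 * _]mulrC.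
Qed.

End mean_square_error.

(** * Sums of powers *)

Section power_sums.
Set Implicit Arguments. Unset Strict Implicit.
Context {R : realType}.
Implicit Types (x y b g : R) (k : nat).

Lemma ler_powRN x y g : 0 < x -> x <= y -> 0 <= g -> y `^ (- g) <= x `^ (- g).
Proof.
move=> x0 xy g0; have y0 := lt_le_trans x0 xy.
rewrite !powRN lef_pV2 ?posrE ?powR_gt0//.
by apply: ge0_ler_powR => //; rewrite nnegrE ltW.
Qed.

Lemma powRB1 x b : 0 < x -> x `^ (b - 1) = x `^ b / x.
Proof.
by move=> x0; rewrite powRB ?powRr1 ?ltW// (gt_eqF x0) implybT.
Qed.

(** This is [ln (1 + t) <= t] at [t = x^-1]; the companion bound below takes [t = - (x + 1)^-1].
    Together they replace a comparison of sums with integrals. *)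
Lemma ln_succ_le x : 0 < x -> ln (x + 1) - ln x <= x^-1.
Proof.
move=> x0; have xV : 0 < x^-1 by rewrite invr_gt0.
have -> : x + 1 = x * (1 + x^-1) by rewrite mulrDr mulr1 divff ?gt_eqF.
rewrite lnM ?posrE ?addr_gt0// addrAC subrr add0r.
by apply: le_ln1Dx; lra.
Qed.

Lemma ln_succ_ge x : 0 < x -> (x + 1)^-1 <= ln (x + 1) - ln x.
Proof.
move=> x0; have x1 : 0 < x + 1 by lra.
have xV : (x + 1)^-1 < 1 by rewrite invf_lt1//; lra.
have -> : ln x = ln ((x + 1) * (1 - (x + 1)^-1)) by congr ln; field; lra.
rewrite lnM ?posrE//; last by lra.
have : ln (1 - (x + 1)^-1) <= - (x + 1)^-1 by apply: le_ln1Dx; lra.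
lra.
Qed.

(** This is [1 + t <= expR t] at [t = b * (ln y - ln x)]. Covering both signs of [b] and both orders
    of [x] and [y], it drives the three estimates of power sums below. *)
Lemma powR_tangent x y b : 0 < x -> 0 < y ->
  x `^ b * (1 + b * (ln y - ln x)) <= y `^ b.
Proof.
move=> x0 y0; rewrite /powR !gt_eqF//.
have -> : b * ln y = b * ln x + b * (ln y - ln x) by ring.
by rewrite expRD ler_wpM2l ?expR_ge0// expR_ge1Dx.
Qed.

(** Telescoping: the tangent at [x] toward [x + 1] bounds a summand by [2 / b] times the increment
    of the [b]-th power, with 2 from [x + 1 <= 2 * x]. Stepping forward is what ends the sum at
    [k.+1], and [b] may lie on either side of 1. *)
Lemma sum_powR_le b k : 0 < b ->
  \sum_(j < k) j.+1%:R `^ (b - 1) <= 2 / b * k.+1%:R `^ b.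
Proof.
move=> b0; elim: k => [|k IHk].
  by rewrite big_ord0 mulr_ge0 ?powR_ge0// divr_ge0// ltW.
rewrite big_ord_recr/=; set x : R := k.+1%:R in IHk *.
have x1 : 1 <= x by rewrite /x ler1n.
have -> : k.+2%:R = x + 1 :> R by rewrite /x -(natr1 k.+1).
move: x x1 IHk => x x1 IHk.
have tg := @powR_tangent x (x + 1) b ltac:(lra) ltac:(lra).
have lg := @ln_succ_ge x ltac:(lra).
have xb := powR_gt0 b (lt_le_trans ltr01 x1).
rewrite powRB1; last by lra.
have h : (2 * x)^-1 <= (x + 1)^-1 by rewrite lef_pV2 ?posrE; lra.
have h2 : x `^ b / x <= 2 / b * (x `^ b * (b * (ln (x + 1) - ln x))).
  have -> : 2 / b * (x `^ b * (b * (ln (x + 1) - ln x))) =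
     x `^ b * (2 * (ln (x + 1) - ln x)) by field; lra.
  rewrite ler_wpM2l ?(ltW xb)//.
  have -> : x^-1 = 2 * (2 * x)^-1 by field; lra.
  by rewrite ler_wpM2l// (le_trans h lg).
have b2 : 0 <= 2 / b by rewrite divr_ge0// ltW.
have := ler_wpM2l b2 tg; lra.
Qed.

(** The tangent at [x + 1] toward [x] bounds the increment by [2 * b] times the next summand. The
    minimum with 1 serves [k = 1], from where the induction runs because the factor 2 needs
    [1 <= x]. *)
Lemma sum_powR_ge b k : 0 < b ->
  Num.min 1 (2 * b)^-1 * k%:R `^ b <= \sum_(j < k) j.+1%:R `^ (b - 1).
Proof.
move=> b0; set c := Num.min _ _.
have c1 : c <= 1 by rewrite /c ge_min lexx.
have c2 : c <= (2 * b)^-1 by rewrite /c ge_min lexx orbT.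
have c0 : 0 < c by rewrite /c lt_min ltr01 invr_gt0 mulr_gt0.
elim: k => [|[|k] IHk].
- by rewrite big_ord0 powR0 ?mulr0// gt_eqF.
- by rewrite big_ord_recl big_ord0 !powR1 mulr1 addr0.
rewrite big_ord_recr/=; set x : R := k.+1%:R in IHk *.
have x1 : 1 <= x by rewrite /x ler1n.
have -> : k.+2%:R = x + 1 :> R by rewrite /x -(natr1 k.+1).
move: x x1 IHk => x x1 IHk.
have tg := @powR_tangent (x + 1) x b ltac:(lra) ltac:(lra).
have lg := @ln_succ_le x ltac:(lra).
have xb : 0 < (x + 1) `^ b by apply: powR_gt0; lra.
rewrite powRB1; last by lra.
have h : x^-1 <= 2 * (x + 1)^-1.
  have -> : 2 * (x + 1)^-1 = ((x + 1) / 2)^-1 by field; lra.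
  by rewrite lef_pV2 ?posrE; lra.
have h2 : (x + 1) `^ b * (b * (ln (x + 1) - ln x)) <=
    2 * b * ((x + 1) `^ b / (x + 1)).
  have -> : 2 * b * ((x + 1) `^ b / (x + 1)) =
     (x + 1) `^ b * (b * (2 * (x + 1)^-1)) by field; lra.
  by rewrite ler_wpM2l ?(ltW xb)// ler_wpM2l ?(ltW b0)//; lra.
have h3 : (x + 1) `^ b - x `^ b <= 2 * b * ((x + 1) `^ b / (x + 1)) by lra.
have h4 : c * (2 * b) <= 1.
  by rewrite -ler_pdivlMr ?div1r//; lra.
have h5 : 0 <= (x + 1) `^ b / (x + 1) by rewrite divr_ge0//; lra.
have := ler_wpM2l (ltW c0) h3; have := ler_wpM2r h5 h4; lra.
Qed.

Lemma sum_powR_bounded b k : b < 0 ->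
  \sum_(j < k) j.+1%:R `^ (b - 1) <= 1 + (- b)^-1.
Proof.
move=> b0; have nb : 0 < (- b)^-1 by rewrite invr_gt0; lra.
case: k => [|k]; first by rewrite big_ord0; lra.
(* The induction runs on a sharper bound, whose increment dominates the next summand. *)
apply: (@le_trans _ _ (1 + (1 - k.+1%:R `^ b) * (- b)^-1)); last first.
  by have := powR_ge0 (k.+1%:R : R) b; nra.
elim: k => [|k IHk].
  by rewrite big_ord_recl big_ord0 !powR1 subrr mul0r.
rewrite big_ord_recr/=; set x : R := k.+1%:R in IHk *.
have x1 : 1 <= x by rewrite /x ler1n.
have -> : k.+2%:R = x + 1 :> R by rewrite /x -(natr1 k.+1).
move: x x1 IHk => x x1 IHk.
have tg := @powR_tangent (x + 1) x b ltac:(lra) ltac:(lra).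
have lg := @ln_succ_ge x ltac:(lra).
have xb : 0 < (x + 1) `^ b by apply: powR_gt0; lra.
rewrite powRB1; last by lra.
have h : (x + 1) `^ b / (x + 1) <= (- b)^-1 * (x `^ b - (x + 1) `^ b).
  apply: (@le_trans _ _ ((- b)^-1 * ((x + 1) `^ b * (- b * (ln (x + 1) - ln x))))).
    have -> : (- b)^-1 * ((x + 1) `^ b * (- b * (ln (x + 1) - ln x))) =
       (x + 1) `^ b * (ln (x + 1) - ln x) by field; lra.
    by rewrite ler_wpM2l// (ltW xb).
  rewrite ler_wpM2l ?(ltW nb)//; lra.
lra.
Qed.

Lemma harmonic_ge_ln k : ln k.+1%:R <= \sum_(j < k) j.+1%:R `^ (-1) :> R.
Proof.
elim: k => [|k IHk]; first by rewrite big_ord0 ln1.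
rewrite big_ord_recr/=; set x : R := k.+1%:R in IHk *.
have x1 : 1 <= x by rewrite /x ler1n.
have -> : k.+2%:R = x + 1 :> R by rewrite /x -(natr1 k.+1).
move: x x1 IHk => x x1 IHk.
rewrite powR_inv1; last by lra.
have := @ln_succ_le x ltac:(lra); lra.
Qed.

Lemma harmonic_le_ln k : (0 < k)%N ->
  \sum_(j < k) j.+1%:R `^ (-1) <= 1 + ln k%:R :> R.
Proof.
case: k => // k _; elim: k => [|k IHk].
  by rewrite big_ord_recl big_ord0 powR1 ln1.
rewrite big_ord_recr/=; set x : R := k.+1%:R in IHk *.
have x1 : 1 <= x by rewrite /x ler1n.
have -> : k.+2%:R = x + 1 :> R by rewrite /x -(natr1 k.+1).
move: x x1 IHk => x x1 IHk.
rewrite powR_inv1; last by lra.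
have := @ln_succ_ge x ltac:(lra); lra.
Qed.

End power_sums.

(** * Balancing variance and bias *)

(** The risk stripped of its constants, used with [a = q - p] for the variance and [g = nu * q] for
    the squared bias. As [powR] sends base 0 with a nonzero exponent to 0, the bias would be lost at
    [k = 0]; hence the restriction to positive [k] below. *)
Definition risk_profile {R : realType} (a g : R) (n k : nat) : R :=
  n%:R^-1 * \sum_(j < k) j.+1%:R `^ a + k%:R `^ (- g).

Section rates.
Set Implicit Arguments. Unset Strict Implicit.
Context {R : realType} {p q nu rho : R}.
Hypotheses (q0 : 0 < q) (nu0 : 0 < nu) (rho0 : 0 < rho).

Let g0 : 0 < nu * q. Proof. exact: mulr_gt0. Qed.

Lemma kn_rate_gt0 n : (0 < n)%N -> 0 < kn_rate p q nu rho n.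
Proof.
move=> n0; have n0R : 0 < n%:R :> R by rewrite ltr0n.
by rewrite /kn_rate; case: ifP => _; apply: powR_gt0; exact: mulr_gt0.
Qed.

(** In these regimes the variance sets the rate, and the level is tuned to bring the bias down to
    order [1 / n]. *)
Lemma kn_rate_powRN n : q - p <= -1 -> (0 < n)%N ->
  kn_rate p q nu rho n `^ (- (nu * q)) = (rho * n%:R)^-1.
Proof.
move=> qp n0; have n0R : 0 < n%:R :> R by rewrite ltr0n.
rewrite /kn_rate qp -powRrM mulrN div1r mulVf ?gt_eqF//.
by rewrite powR_inv1// mulr_ge0 ?(ltW rho0) ?(ltW n0R).
Qed.

(* The level [kn_rate] balances the two terms of the profile: with [r] the bias
   term, the variance term is [rho * r], which is exactly the rate. *)
Lemma rate_balance n : -1 < q - p -> (0 < n)%N ->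
  let r := kn_rate p q nu rho n `^ (- (nu * q)) in
  rate p q nu rho n = rho * r /\
  kn_rate p q nu rho n `^ (q - p + 1) = rho * n%:R * r.
Proof.
move=> qp n0 r; have n0R : 0 < n%:R :> R by rewrite ltr0n.
set D := (1 + nu) * q + 1 - p.
have DE : D = (q - p + 1) + nu * q by rewrite /D; ring.
have D0 : 0 < D by rewrite DE; have : 0 < nu * q := g0; lra.
have x0 : 0 < rho * n%:R by exact: mulr_gt0.
have tauE : kn_rate p q nu rho n = (rho * n%:R) `^ (1 / D).
  by rewrite /kn_rate ifF// leNgt qp.
have rE : r = (rho * n%:R) `^ (- (nu * q / D)).
  by rewrite /r tauE -powRrM; congr (_ `^ _); field; lra.
split; last first.
  rewrite tauE rE -powRrM -{2}[rho * n%:R]powRr1 ?ltW// -powRD ?(gt_eqF x0) ?implybT//.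
  by congr (_ `^ _); move: D0; rewrite DE => D0; field; lra.
rewrite /rate ltNge ltW//= gt_eqF// rE.
have -> : nu / (nu + 1 - (p - 1) / q) = nu * q / D.
  have -> : nu + 1 - (p - 1) / q = D / q by rewrite /D; field; rewrite gt_eqF.
  by rewrite invf_div mulrA.
have -> : (q + 1 - p) / ((nu + 1) * q + 1 - p) = 1 - nu * q / D.
  by move: D0; rewrite DE => D0; field; lra.
rewrite powRM ?ltW// mulrA; congr (_ * _).
  rewrite -{2}[rho]powRr1 ?ltW// -powRD// (gt_eqF rho0) implybT//.
by rewrite -[n%:R^-1]powR_inv1 ?ltW// -powRrM mulN1r.
Qed.

(** The first summand of the variance already contributes [1 / n]. *)
Lemma profile_ge_rate_fast : q - p < -1 ->
  exists c : R, 0 < c /\ forall n k, (0 < n)%N -> (0 < k)%N ->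
    c * rate p q nu rho n <= risk_profile (q - p) (nu * q) n k.
Proof.
move=> qp; exists 1; split => // n k n0 k0; rewrite mul1r /rate qp /risk_profile.
have n0R : 0 < n%:R^-1 :> R by rewrite invr_gt0 ltr0n.
case: k k0 => // k _; rewrite big_ord_recl powR1.
have S0 : 0 <= \sum_(i < k) (lift ord0 i).+1%:R `^ (q - p).
  by apply: sumr_ge0 => j _; exact: powR_ge0.
have := powR_ge0 (k.+1%:R : R) (- (nu * q)); nra.
Qed.

(** With [x = rho * n], split at [k = x^(1/(2g))]. Above, the harmonic sum is at least
    [ln x / (2g)]. Below, the bias is at least [x^(-1/2)], which dominates [ln x / x] up to a factor
    2. *)
Lemma profile_ge_rate_log : q - p = -1 ->
  exists c : R, 0 < c /\ forall n k, 1 <= rho * n%:R -> (0 < n)%N -> (0 < k)%N ->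
    c * rate p q nu rho n <= risk_profile (q - p) (nu * q) n k.
Proof.
move=> qp; set g := nu * q; have gp : 0 < g := g0.
have c0 : 0 < Num.min (2 * g)^-1 (2 * rho)^-1.
  by rewrite lt_min !invr_gt0 !mulr_gt0.
exists (Num.min (2 * g)^-1 (2 * rho)^-1); split => // n k x1 n0 k0.
set c := Num.min _ _ in c0 *.
have c1 : c <= (2 * g)^-1 by rewrite /c ge_min lexx.
have c2 : c <= (2 * rho)^-1 by rewrite /c ge_min lexx orbT.
have n0R : 0 < n%:R :> R by rewrite ltr0n.
have k0R : 0 < k%:R :> R by rewrite ltr0n.
rewrite /risk_profile qp /rate qp ltxx eqxx mulrC [n%:R * rho]mulrC.
set x := rho * n%:R in x1 *.
have x0 : 0 < x by lra.
have lx : 0 <= ln x by exact: ln_ge0.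
have hS := @harmonic_ge_ln R k; set S := \sum_(j < k) _ in hS *.
have S0 : 0 <= S by apply: sumr_ge0 => j _; exact: powR_ge0.
have kg := powR_ge0 (k%:R : R) (- g).
have nV : 0 < n%:R^-1 :> R by rewrite invr_gt0.
have [kx|kx] := leP (x `^ (2 * g)^-1) k%:R.
  have hl : (2 * g)^-1 * ln x <= S.
    rewrite -ln_powR; apply: le_trans hS.
    rewrite ler_ln ?posrE ?powR_gt0//.
    by apply: le_trans kx _; rewrite ler_nat.
  have h1 : c * ln x <= S by apply: le_trans hl; rewrite ler_wpM2r.
  have := ler_wpM2l (ltW nV) h1.
  lra.
have hb : x `^ (- 2^-1) <= k%:R `^ (- g).
  have -> : x `^ (- 2^-1) = (x `^ (2 * g)^-1) `^ (- g).
    by rewrite -powRrM; congr (_ `^ _); field; lra.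
  by apply: ler_powRN => //; exact: ltW.
(* This is [ln y < y] at the square root of [x]. *)
have hs : ln x <= 2 * x `^ 2^-1.
  have := ltW (ln_sublinear (powR_gt0 2^-1 x0)); rewrite ln_powR; lra.
have xs : x * x `^ (- 2^-1) = x `^ 2^-1.
  rewrite -{1}[x]powRr1 ?ltW// -powRD ?(gt_eqF x0) ?implybT//.
  by congr (_ `^ _); field.
(* Passing from [n] to [x] costs a factor [rho], which the bound [(2 * rho)^-1] on [c] absorbs. *)
have -> : ln x / n%:R * c = c * rho * (ln x / x).
  by rewrite /x; field; rewrite !gt_eqF.
have h3 : ln x / x <= 2 * x `^ (- 2^-1).
  by rewrite ler_pdivrMr// -mulrA [_ * x]mulrC xs.
have h4 : c * rho <= 2^-1.
  have := ler_wpM2r (ltW rho0) c2.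
  by have -> : (2 * rho)^-1 * rho = 2^-1 by field; rewrite gt_eqF.
have h5 : c * rho * (ln x / x) <= 2^-1 * (2 * x `^ (- 2^-1)).
  by apply: ler_pM => //; [rewrite mulr_ge0 ?(ltW c0) ?(ltW rho0)|rewrite divr_ge0 ?(ltW x0)].
have h6 : 0 <= n%:R^-1 * S by rewrite mulr_ge0 ?(ltW nV).
lra.
Qed.

(** Split at the balancing level [tau]: above it the increasing variance is at least its order at
    [tau], below it the decreasing bias is at least its value at [tau]. Both are of the order of the
    rate. *)
Lemma profile_ge_rate_slow : -1 < q - p ->
  exists c : R, 0 < c /\ forall n k, (0 < n)%N -> (0 < k)%N ->
    c * rate p q nu rho n <= risk_profile (q - p) (nu * q) n k.
Proof.
move=> qp; set b := q - p + 1; have b0 : 0 < b by rewrite /b; lra.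
set c1 := Num.min 1 (2 * b)^-1.
have c10 : 0 < c1 by rewrite lt_min ltr01 invr_gt0 mulr_gt0.
have c0 : 0 < Num.min rho^-1 c1 by rewrite lt_min invr_gt0 rho0.
exists (Num.min rho^-1 c1); split => // n k n0 k0.
set c := Num.min _ _ in c0 *.
have cr : c <= rho^-1 by rewrite /c ge_min lexx.
have cc : c <= c1 by rewrite /c ge_min lexx orbT.
have n0R : 0 < n%:R :> R by rewrite ltr0n.
have nV : 0 < n%:R^-1 :> R by rewrite invr_gt0.
have k0R : 0 < k%:R :> R by rewrite ltr0n.
have [-> tb] := rate_balance qp n0; rewrite -/b in tb.
have t0 := kn_rate_gt0 n0; set tau := kn_rate p q nu rho n in tb t0 *.
set r := tau `^ (- (nu * q)) in tb *; have r0 : 0 < r by exact: powR_gt0.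
rewrite /risk_profile; have := @sum_powR_ge R b k b0.
have -> : b - 1 = q - p by rewrite /b; ring.
rewrite -/c1; set S := \sum_(j < k) _ => hS.
have S0 : 0 <= S by apply: sumr_ge0 => j _; exact: powR_ge0.
have kg := powR_ge0 (k%:R : R) (- (nu * q)).
have [kt|kt] := leP tau k%:R.
  have h1 : tau `^ b <= k%:R `^ b.
    by apply: ge0_ler_powR; rewrite ?nnegrE ?(ltW b0) ?(ltW t0).
  have h2 : c1 * (rho * n%:R * r) <= S.
    by apply: le_trans hS; rewrite -tb ler_wpM2l// ltW.
  have h3 := ler_wpM2l (ltW nV) h2.
  have E : n%:R^-1 * (c1 * (rho * n%:R * r)) = c1 * (rho * r) by field; lra.
  rewrite E in h3.
  have h4 : c * (rho * r) <= c1 * (rho * r) by rewrite ler_wpM2r// mulr_ge0 ?(ltW rho0) ?(ltW r0).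
  lra.
have h1 : r <= k%:R `^ (- (nu * q)) by apply: ler_powRN => //; exact: ltW.
have h2 : c * (rho * r) <= rho^-1 * (rho * r) by rewrite ler_wpM2r// mulr_ge0 ?(ltW rho0) ?(ltW r0).
rewrite mulKf ?gt_eqF// in h2.
have h3 : 0 <= n%:R^-1 * S by rewrite mulr_ge0 ?(ltW nV).
lra.
Qed.

Lemma profile_le_rate_fast c C : 0 < c -> 0 < C -> q - p < -1 ->
  exists M : R, 0 < M /\ forall n k, (0 < n)%N ->
    c * kn_rate p q nu rho n <= k%:R <= C * kn_rate p q nu rho n ->
    risk_profile (q - p) (nu * q) n k <= M * rate p q nu rho n.
Proof.
move=> c0 C0 qp; pose b := q - p + 1; have b0 : b < 0 by rewrite /b; lra.
pose M := 1 + (- b)^-1 + c `^ (- (nu * q)) / rho.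
have M1 : 0 < 1 + (- b)^-1 by rewrite addr_gt0// invr_gt0; lra.
have M2 : 0 < c `^ (- (nu * q)) / rho by rewrite divr_gt0// powR_gt0.
exists M; split; first by rewrite /M addr_gt0.
move=> n k n0 /andP[ck kC]; rewrite /rate qp /risk_profile.
have n0R : 0 < n%:R :> R by rewrite ltr0n.
have nV : 0 < n%:R^-1 :> R by rewrite invr_gt0.
have t0 := kn_rate_gt0 n0.
have hS := @sum_powR_bounded R b k b0.
have bE : b - 1 = q - p by rewrite /b; ring.
rewrite bE in hS.
have hb : k%:R `^ (- (nu * q)) <= c `^ (- (nu * q)) / rho * n%:R^-1.
  apply: le_trans (ler_powRN (mulr_gt0 c0 t0) ck (ltW g0)) _.
  by rewrite powRM ?(ltW c0) ?(ltW t0)// (kn_rate_powRN (ltW qp) n0) invfM mulrA.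
have := ler_wpM2l (ltW nV) hS; rewrite /M; lra.
Qed.

Lemma profile_le_rate_log c C : 0 < c -> 0 < C -> q - p = -1 ->
  exists M : R, 0 < M /\ forall n k, expR 1 <= rho * n%:R -> (0 < n)%N ->
    c * kn_rate p q nu rho n <= k%:R <= C * kn_rate p q nu rho n ->
    risk_profile (q - p) (nu * q) n k <= M * rate p q nu rho n.
Proof.
move=> c0 C0 qp; set g := nu * q; have gp : 0 < g := g0.
(* In order: the constant of the harmonic bound, the slack in [k], the exponent of the level, the
   bias. All are measured against [ln (rho * n)], which is at least 1 by the lower bound on
   [rho * n]. *)
pose M := 1 + `|ln C| + g^-1 + c `^ (- g) / rho.
have M1 : 0 < c `^ (- g) / rho by rewrite divr_gt0// powR_gt0.
have gV : 0 < g^-1 by rewrite invr_gt0.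
exists M; split; first by rewrite /M; have := normr_ge0 (ln C); lra.
move=> n k xe n0 /andP[ck kC].
have n0R : 0 < n%:R :> R by rewrite ltr0n.
have nV : 0 < n%:R^-1 :> R by rewrite invr_gt0.
have t0 := kn_rate_gt0 n0.
have k0R : 0 < k%:R :> R by apply: lt_le_trans ck; exact: mulr_gt0.
have k0 : (0 < k)%N by rewrite -(ltr0n R).
have qple : q - p <= -1 by rewrite qp.
have lx : 1 <= ln (rho * n%:R).
  by rewrite -[leLHS]expRK ler_ln ?posrE ?expR_gt0// mulr_gt0.
have lk : ln k%:R <= ln C + g^-1 * ln (rho * n%:R).
  have -> : g^-1 * ln (rho * n%:R) = ln (kn_rate p q nu rho n).
    by rewrite /kn_rate qple ln_powR div1r.
  by rewrite -lnM ?posrE// ler_ln ?posrE// mulr_gt0.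
have hb : k%:R `^ (- g) <= c `^ (- g) / rho * n%:R^-1.
  apply: le_trans (ler_powRN (mulr_gt0 c0 t0) ck (ltW g0)) _.
  by rewrite powRM ?(ltW c0) ?(ltW t0)// (kn_rate_powRN qple n0) invfM mulrA.
rewrite /risk_profile /rate qp ltxx eqxx [n%:R * rho]mulrC.
have hS := @harmonic_le_ln R k k0; set S := \sum_(j < k) _ in hS *.
set L := ln (rho * n%:R) in lx lk *.
have hS2 : S + c `^ (- g) / rho <= M * L.
  have lC := ler_norm (ln C); have aC := normr_ge0 (ln C).
  rewrite /M; nra.
have := ler_wpM2l (ltW nV) hS2; lra.
Qed.

Lemma profile_le_rate_slow c C : 0 < c -> 0 < C -> -1 < q - p ->
  exists M : R, 0 < M /\ forall n k, (0 < n)%N ->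
    c * kn_rate p q nu rho n <= k%:R <= C * kn_rate p q nu rho n ->
    risk_profile (q - p) (nu * q) n k <= M * rate p q nu rho n.
Proof.
move=> c0 C0 qp; set b := q - p + 1; have b0 : 0 < b by rewrite /b; lra.
(* The sum is bounded through [k.+1], and [k.+1 <= 2 * k] turns [C] into [2 * C]. *)
pose M1 := 2 / b * (2 * C) `^ b.
have M10 : 0 < M1 by rewrite mulr_gt0 ?divr_gt0 ?powR_gt0 ?mulr_gt0.
have M20 : 0 < c `^ (- (nu * q)) / rho by rewrite divr_gt0// powR_gt0.
exists (M1 + c `^ (- (nu * q)) / rho); split; first exact: addr_gt0.
move=> n k n0 /andP[ck kC].
have n0R : 0 < n%:R :> R by rewrite ltr0n.
have nV : 0 < n%:R^-1 :> R by rewrite invr_gt0.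
have [-> tb] := rate_balance qp n0; rewrite -/b in tb.
have t0 := kn_rate_gt0 n0; set tau := kn_rate p q nu rho n in tb t0 ck kC *.
have k1 : 1 <= k%:R :> R.
  by rewrite ler1n -(ltr0n R); apply: lt_le_trans ck; exact: mulr_gt0.
have hb : k%:R `^ (- (nu * q)) <= c `^ (- (nu * q)) * tau `^ (- (nu * q)).
  apply: le_trans (ler_powRN (mulr_gt0 c0 t0) ck (ltW g0)) _.
  by rewrite powRM ?(ltW c0) ?(ltW t0).
set r := tau `^ (- (nu * q)) in tb hb *; have r0 : 0 < r by exact: powR_gt0.
rewrite /risk_profile; have := @sum_powR_le R b k b0.
have -> : b - 1 = q - p by rewrite /b; ring.
set S := \sum_(j < k) _ => hS.
have h1 : k.+1%:R `^ b <= (2 * C) `^ b * (rho * n%:R * r).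
  rewrite -tb -powRM ?(ltW t0) ?mulr_ge0 ?(ltW C0)//.
  apply: ge0_ler_powR; rewrite ?(ltW b0) ?nnegrE ?mulr_ge0 ?(ltW C0) ?(ltW t0)//.
  by rewrite -natr1 -mulrA; lra.
have b2 : 0 <= 2 / b by rewrite divr_ge0// ltW.
have h2 : S <= M1 * (rho * n%:R * r).
  by apply: le_trans hS _; rewrite /M1 -[leRHS]mulrA ler_wpM2l.
have h3 := ler_wpM2l (ltW nV) h2.
have E1 : n%:R^-1 * (M1 * (rho * n%:R * r)) = M1 * (rho * r) by field; lra.
have E2 : (M1 + c `^ (- (nu * q)) / rho) * (rho * r) =
    M1 * (rho * r) + c `^ (- (nu * q)) * r by field; rewrite gt_eqF.
rewrite E1 in h3; rewrite E2; lra.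
Qed.

Lemma profile_ge_rate : exists c : R, 0 < c /\ forall n k,
  expR 1 <= rho * n%:R -> (0 < n)%N -> (0 < k)%N ->
  c * rate p q nu rho n <= risk_profile (q - p) (nu * q) n k.
Proof.
have [qp|qp|qp] := ltgtP (q - p) (-1).
- have [c [c0 h]] := profile_ge_rate_fast qp.
  by exists c; split => // n k _; exact: h.
- have [c [c0 h]] := profile_ge_rate_slow qp.
  by exists c; split => // n k _; exact: h.
- have [c [c0 h]] := profile_ge_rate_log qp.
  exists c; split => // n k xe; apply: h; apply: le_trans xe.
  by have := expR_ge1Dx (1 : R); lra.
Qed.

Lemma profile_le_rate c C : 0 < c -> 0 < C -> exists M : R, 0 < M /\ forall n k,
  expR 1 <= rho * n%:R -> (0 < n)%N ->
  c * kn_rate p q nu rho n <= k%:R <= C * kn_rate p q nu rho n ->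
  risk_profile (q - p) (nu * q) n k <= M * rate p q nu rho n.
Proof.
move=> c0 C0; have [qp|qp|qp] := ltgtP (q - p) (-1).
- have [M [M0 h]] := profile_le_rate_fast c0 C0 qp.
  by exists M; split => // n k _; exact: h.
- have [M [M0 h]] := profile_le_rate_slow c0 C0 qp.
  by exists M; split => // n k _; exact: h.
- exact: profile_le_rate_log.
Qed.

(** Guarantees that rounding the level up to an integer at most doubles it. *)
Lemma kn_rate_ge1 n : 1 <= rho * n%:R -> 1 <= kn_rate p q nu rho n.
Proof.
move=> x1; rewrite /kn_rate; case: ifPn => qp.
  by rewrite -[leLHS](powRr0 (rho * n%:R)) ler_powR// divr_ge0// ltW.
rewrite -[leLHS](powRr0 (rho * n%:R)) ler_powR// divr_ge0//.
by have : 0 < nu * q := g0; rewrite -ltNge in qp; lra.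
Qed.

End rates.

(** The variance compares summand by summand and the bias at the single index [k], so the two-sided
    power bounds pass to the whole risk with constants uniform in [n] and [k]. *)
Lemma risk_profile_equiv (R : realType) (s sigma : nat -> R)
    (p q nu rho c1 C1 c2 C2 : R) :
  0 < q -> 0 < nu -> 0 < rho -> 0 < c1 -> 0 < C1 -> 0 < c2 -> 0 < C2 ->
  (forall j, 0 < sigma j) ->
  (forall j, c1 * j.+1%:R `^ (- q) <= sigma j ^+ 2 <= C1 * j.+1%:R `^ (- q)) ->
  (forall j, c2 * j.+1%:R `^ (- p) <= s j <= C2 * j.+1%:R `^ (- p)) ->
  exists m M : R, [/\ 0 < m, 0 < M & forall n k, (0 < k)%N ->
    m * risk_profile (q - p) (nu * q) n k <=
      n%:R^-1 * \sum_(j < k) s j / sigma j ^+ 2 + rho ^+ 2 * (sigma k `^ nu) ^+ 2 <=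
    M * risk_profile (q - p) (nu * q) n k].
Proof.
move=> q0 nu0 rho0 c10 C10 c20 C20 sg0 sgb sb.
have term j : c2 / C1 * j.+1%:R `^ (q - p) <= s j / sigma j ^+ 2 <=
    C2 / c1 * j.+1%:R `^ (q - p).
  have x0 : 0 < j.+1%:R :> R by rewrite ltr0n.
  have sg2 : 0 < sigma j ^+ 2 by rewrite exprn_gt0.
  have xq : 0 < j.+1%:R `^ (- q) :> R by exact: powR_gt0.
  have xp : 0 < j.+1%:R `^ (- p) :> R by exact: powR_gt0.
  have -> : j.+1%:R `^ (q - p) = j.+1%:R `^ (- p) / j.+1%:R `^ (- q) :> R.
    by rewrite -powRB ?(gt_eqF x0) ?implybT// opprK addrC.
  have /andP[sg_lo sg_hi] := sgb j; have /andP[s_lo s_hi] := sb j.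
  have s0 : 0 <= s j by apply: le_trans s_lo; rewrite mulr_ge0 ?(ltW c20) ?(ltW xp).
  rewrite !mulf_div; apply/andP; split.
    apply: ler_pM => //; first by rewrite mulr_ge0 ?(ltW c20) ?(ltW xp).
      by rewrite invr_ge0 mulr_ge0 ?(ltW C10) ?(ltW xq).
    by rewrite lef_pV2 ?posrE ?(mulr_gt0 C10 xq).
  apply: ler_pM => //; first by rewrite invr_ge0 (ltW sg2).
  by rewrite lef_pV2 ?posrE ?(mulr_gt0 c10 xq).
(* [sigma k] is of the order of a power of [k.+1] but the profile uses [k]; [k.+1 <= 2 * k] costs
   the power of 2. *)
have bias k : (0 < k)%N -> c1 `^ nu * 2 `^ (- (nu * q)) * k%:R `^ (- (nu * q)) <=
    (sigma k `^ nu) ^+ 2 <= C1 `^ nu * k%:R `^ (- (nu * q)).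
  move=> k0; have k0R : 0 < k%:R :> R by rewrite ltr0n.
  have k1R : 0 < k.+1%:R :> R by rewrite ltr0n.
  have g0 : 0 <= nu * q by rewrite mulr_ge0// ltW.
  have xq : 0 <= k.+1%:R `^ (- q) :> R by exact: powR_ge0.
  have -> : (sigma k `^ nu) ^+ 2 = (sigma k ^+ 2) `^ nu.
    by rewrite -powR_mulrn ?powR_ge0// powRAC powR_mulrn// ltW.
  have scale c : 0 < c -> (c * k.+1%:R `^ (- q)) `^ nu =
      c `^ nu * k.+1%:R `^ (- (nu * q)).
    by move=> c0; rewrite powRM ?(ltW c0)// -powRrM mulNr [q * nu]mulrC.
  have /andP[sg_lo sg_hi] := sgb k; apply/andP; split.
    apply: (@le_trans _ _ ((c1 * k.+1%:R `^ (- q)) `^ nu)); last first.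
      by apply: ge0_ler_powR; rewrite ?nnegrE ?(ltW nu0) ?sqr_ge0 ?mulr_ge0 ?(ltW c10).
    rewrite scale// -mulrA ler_wpM2l ?powR_ge0// -powRM ?(ltW k0R)//.
    apply: ler_powRN => //; rewrite -natrM ler_nat mul2n -addnn -addn1.
    by rewrite leq_add2l.
  apply: (@le_trans _ _ ((C1 * k.+1%:R `^ (- q)) `^ nu)).
    by apply: ge0_ler_powR; rewrite ?nnegrE ?(ltW nu0) ?sqr_ge0 ?mulr_ge0 ?(ltW C10).
  by rewrite scale// ler_wpM2l ?powR_ge0//; apply: ler_powRN => //; rewrite ler_nat.
pose m1 := c2 / C1; pose m2 := rho ^+ 2 * (c1 `^ nu * 2 `^ (- (nu * q))).
pose M1 := C2 / c1; pose M2 := rho ^+ 2 * C1 `^ nu.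
have m10 : 0 < m1 by rewrite divr_gt0.
have m20 : 0 < m2 by rewrite !mulr_gt0 ?powR_gt0.
have M10 : 0 < M1 by rewrite divr_gt0.
have M20 : 0 < M2 by rewrite !mulr_gt0 ?powR_gt0.
exists (Num.min m1 m2), (Num.max M1 M2); split.
- by rewrite lt_min m10.
- by rewrite lt_max M10.
move=> n k k0; rewrite /risk_profile !mulrDr.
set S := \sum_(j < k) j.+1%:R `^ _; set B := k%:R `^ _.
have S0 : 0 <= S by apply: sumr_ge0 => j _; exact: powR_ge0.
have B0 : 0 <= B by exact: powR_ge0.
have nV : 0 <= n%:R^-1 :> R by rewrite invr_ge0.
have nS : 0 <= n%:R^-1 * S by exact: mulr_ge0.
have /andP[b_lo b_hi] := bias k k0; rewrite -/B in b_lo b_hi.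
have r2 : 0 <= rho ^+ 2 by exact: sqr_ge0.
have v_lo : m1 * S <= \sum_(j < k) s j / sigma j ^+ 2.
  by rewrite mulr_sumr; apply: ler_sum => j _; case/andP: (term j).
have v_hi : \sum_(j < k) s j / sigma j ^+ 2 <= M1 * S.
  by rewrite mulr_sumr; apply: ler_sum => j _; case/andP: (term j).
apply/andP; split; apply: lerD.
- apply: (@le_trans _ _ (m1 * (n%:R^-1 * S))).
    by rewrite ler_wpM2r// ge_min lexx.
  by rewrite mulrCA ler_wpM2l.
- apply: (@le_trans _ _ (m2 * B)); first by rewrite ler_wpM2r// ge_min lexx orbT.
  by rewrite /m2 -[leLHS]mulrA ler_wpM2l.
- apply: (@le_trans _ _ (M1 * (n%:R^-1 * S))).
    by rewrite mulrCA ler_wpM2l.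
  by rewrite ler_wpM2r// le_max lexx.
- apply: (@le_trans _ _ (M2 * B)); last by rewrite ler_wpM2r// le_max lexx orbT.
  by rewrite /M2 -[leRHS]mulrA ler_wpM2l.
Qed.

Theorem theorem1 (R : realType) (X Y : normedModType R)
  (ipX : X -> X -> R) (ipY : Y -> Y -> R) (K : X -> Y)
  (sigma : nat -> R) (u : nat -> Y) (v : nat -> X)
  (d : measure_display) (T : measurableType d) (P : probability T R)
  (E : nat -> T -> Y) (p q nu rho : R) :
  inner_product ipX -> inner_product ipY ->
  linear_op K -> continuous K -> compact_op K -> closure (range K) = setT ->
  is_SVD ipX ipY K sigma u v ->
  (forall i, Y_rv ipY (E i)) ->
  mutually_independent P ipY E -> identically_distributed P ipY E ->
  (forall y, P.-integrable setT (fun w => (ipY (E 0%N w) y)%:E) /\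
             (\int[P]_w (ipY (E 0%N w) y)%:E = 0)%E) ->
  (\int[P]_w ((`|E 0%N w| ^+ 2)%:E) < +oo)%E ->
  0 < q -> 1 < p ->
  asymp (fun j => (sigma j ^+ 2)%:E) (fun j => ((j.+1)%:R `^ (- q))%:E) ->
  asymp (fun j => (\int[P]_w ((ipY (E 0%N w) (u j)) ^+ 2)%:E)%E)
        (fun j => ((j.+1)%:R `^ (- p))%:E) ->
  0 < nu -> 0 < rho ->
  let worst := fun n k =>
    ereal_sup (mse P ipY K sigma u v E n k @` source_set ipX sigma v nu rho) in
  let best := fun n => ereal_inf [set worst n k | k in [set k : nat | (1 <= k)%N]] in
  asymp_n best (fun n => (rate p q nu rho n)%:E) /\
  (forall kn : nat -> nat,
     asymp_n (fun n => (kn n)%:R%:E) (fun n => (kn_rate p q nu rho n)%:E) ->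
     asymp_n (fun n => worst n (kn n)) best).
Proof.
move=> ipXP ipYP Klin Kcont _ _ svd mE indE idE meanE _ q0 _.
move=> [c1 [C1 [c10 C10 sgb]]] [c2 [C2 [c20 C20 sb]]] nu0 rho0 worst best.
(* The upper half of the decay assumption makes these moments finite, so [fine] loses nothing. *)
pose s j := fine (\int[P]_w ((ipY (E 0%N w) (u j)) ^+ 2)%:E)%E.
have varE j : (\int[P]_w ((ipY (E 0%N w) (u j)) ^+ 2)%:E = (s j)%:E)%E.
  rewrite /s fineK// ge0_fin_numE; last first.
    by apply: integral_ge0 => w _; rewrite lee_fin sqr_ge0.
  by apply: le_lt_trans (sb j).2 _; rewrite -EFinM ltry.
have sg0 j : 0 < sigma j by case: svd => _ _ [] /(_ j).
have sgb' j : c1 * j.+1%:R `^ (- q) <= sigma j ^+ 2 <= C1 * j.+1%:R `^ (- q).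
  by have [] := sgb j; rewrite -!EFinM !lee_fin => -> ->.
have sb' j : c2 * j.+1%:R `^ (- p) <= s j <= C2 * j.+1%:R `^ (- p).
  by have [] := sb j; rewrite varE -!EFinM !lee_fin => -> ->.
have [m [M [m0 M0 mM]]] :=
  @risk_profile_equiv _ _ _ _ _ _ _ _ _ _ _ q0 nu0 rho0 c10 C10 c20 C20 sg0 sgb' sb'.
have worstE n k : (0 < n)%N -> worst n k =
    (n%:R^-1 * \sum_(j < k) s j / sigma j ^+ 2 + rho ^+ 2 * (sigma k `^ nu) ^+ 2)%:E.
  by move=> n0; exact: worst_mse_formula.
(* From [N0] on [rho * n] is at least [e], which keeps the logarithmic rate away from 0. *)
pose N0 := (Num.truncn (expR 1 / rho)).+1.
have N0P n : (N0 <= n)%N -> (0 < n)%N /\ expR 1 <= rho * n%:R.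
  move=> Nn; split; first exact: leq_trans Nn.
  rewrite mulrC -ler_pdivrMr//; apply: le_trans (ltW (truncnS_gt _)) _.
  by rewrite ler_nat.
have [cl [cl0 lower]] := profile_ge_rate (p := p) q0 nu0 rho0.
have worst_ge n k : (N0 <= n)%N -> (0 < k)%N ->
    ((m * cl * rate p q nu rho n)%:E <= worst n k)%E.
  move=> /N0P[n0 xe] k0; rewrite worstE// lee_fin.
  have /andP[h _] := mM n k k0; apply: le_trans h.
  by rewrite -mulrA ler_wpM2l ?(ltW m0)// lower.
(* Kept general in [c] and [C]: used with 1 and 2 to bound the infimum, then with the constants of
   an arbitrary [kn]. *)
have worst_le (c C : R) : 0 < c -> 0 < C -> exists2 A : R, 0 < A & forall n k,
    (N0 <= n)%N -> c * kn_rate p q nu rho n <= k%:R <= C * kn_rate p q nu rho n ->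
    (0 < k)%N /\ (worst n k <= (A * rate p q nu rho n)%:E)%E.
  move=> c0 C0; have [A [A0 upper]] := profile_le_rate (p := p) q0 nu0 rho0 c0 C0.
  exists (M * A); first exact: mulr_gt0.
  move=> n k /N0P[n0 xe] ckC.
  have k0 : (0 < k)%N.
    rewrite -(ltr0n R); have /andP[ck _] := ckC; apply: lt_le_trans ck.
    by rewrite mulr_gt0// kn_rate_gt0.
  split => //; rewrite worstE// lee_fin.
  have /andP[_ h] := mM n k k0; apply: le_trans h _.
  by rewrite -mulrA ler_wpM2l ?(ltW M0)// upper.
have best_ge n : (N0 <= n)%N -> ((m * cl * rate p q nu rho n)%:E <= best n)%E.
  move=> Nn; apply: le_ereal_inf_tmp => _ [k k0 <-]; exact: worst_ge.
have best_le n k : (0 < k)%N -> (best n <= worst n k)%E.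
  by move=> k0; apply: ereal_inf_lbound; exists k.
have mcl : 0 < m * cl by exact: mulr_gt0.
split.
  have [A A0 hA] := worst_le 1 2 ltr01 (ltr0Sn R 1).
  exists (m * cl), A, N0; split => // n Nn; split.
    by rewrite -EFinM; exact: best_ge.
  have [n0 xe] := N0P n Nn; rewrite -EFinM.
  (* An integer between the ideal level and its double, as that level is at least 1. *)
  pose k := (Num.truncn (kn_rate p q nu rho n)).+1.
  have t1 : 1 <= kn_rate p q nu rho n.
    apply: kn_rate_ge1 => //; apply: le_trans xe.
    by have := expR_ge1Dx (1 : R); lra.
  have kb : 1 * kn_rate p q nu rho n <= k%:R <= 2 * kn_rate p q nu rho n.
    have /andP[t_lo t_hi] := truncn_itv (le_trans ler01 t1).
    apply/andP; split; first by rewrite mul1r ltW.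
    by rewrite /k -natr1; lra.
  have [k0 hk] := hA n k Nn kb.
  by apply: le_trans hk; exact: best_le.
move=> kn [c [C [N [c0 C0 knb]]]].
have [A A0 hA] := worst_le c C c0 C0.
(* The lower constant is 1 because [kn n] is itself a competitor in the infimum; the upper one
   passes through the rate, at most [best n / (m * cl)]. *)
exists 1, (A / (m * cl)), (maxn N0 N); split => //; first by rewrite divr_gt0.
move=> n; rewrite geq_max => /andP[Nn Nn'].
have kb : c * kn_rate p q nu rho n <= (kn n)%:R <= C * kn_rate p q nu rho n.
  by have [] := knb n Nn'; rewrite -!EFinM !lee_fin => -> ->.
have [k0 hk] := hA n (kn n) Nn kb; split; first by rewrite mul1e; exact: best_le.
apply: le_trans hk _.
have AV : (0 <= (A / (m * cl))%:E)%E by rewrite lee_fin divr_ge0 ?(ltW A0) ?(ltW mcl).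
apply: le_trans (lee_wpmul2l AV (best_ge n Nn)).
by rewrite -EFinM mulrA divfK// gt_eqF.
Qed.
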